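(* Let $\alpha\in{]0,1[}$ and let $\mathcal B$ be a pointed semitopological barycentric algebra. Let $\eta\colon\mathcal B\to\mathrm{tscope}_\alpha(\mathcal B)$ be the map $x\mapsto[(0,x)]_\alpha$. Then: 1. $\mathrm{tscope}_\alpha(\mathcal B)$, with its quotient topology, is a semitopological cone. 2. The map $\eta$ is linear and continuous. 3. For every continuous map $f\colon\mathcal B\to\mathfrak C$ to a semitopological cone $\mathfrak C$ that commutes with $\alpha\cdot\_$ (i.e. $f(\alpha\cdot x)=\alpha\cdot f(x)$ for every $x$), there is a unique continuous map $\hat f\colon\mathrm{tscope}_\alpha(\mathcal B)\to\mathfrak C$ that commutes with $\alpha\cdot\_$ and such that $\hat f\circ\eta=f$. If $f$ is affine (resp. concave, convex, strict, linear, superlinear, sublinear), then so is $\hat f$; if $f$ is $\mathbb I$-homogeneous, then $\hat f$ is positively homogeneous. 4. In particular, $\mathrm{tscope}_\alpha(\mathcal B)$ is the free semitopological cone over the pointed semitopological barycentric algebra $\mathcal B$, and this is independent of $\alpha$ up to natural isomorphism of semitopological cones.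
   Context: $\mathbb R_+=[0,\infty[$ carries the Scott topology (open sets $]a,\infty[$, $\mathbb R_+$, $\emptyset$). A cone is a commutative monoid $(\mathfrak C,+,0)$ with an action of $\mathbb R_+$ satisfying $0\cdot x=0$, $(ab)\cdot x=a\cdot(b\cdot x)$, $1\cdot x=x$, $a\cdot0=0$, $a\cdot(x+y)=a\cdot x+a\cdot y$, $(a+b)\cdot x=a\cdot x+b\cdot x$; it is semitopological if it has a topology making $+$ and $\cdot$ separately continuous, and then it is preordered by its specialization preordering ($x\le y$ iff every open neighborhood of $x$ contains $y$). A barycentric algebra is a set $\mathcal B$ with operations $+_a$, $a\in[0,1]$, such that $x+_1y=x$, $x+_ax=x$, $x+_ay=y+_{1-a}x$, $(x+_ay)+_bz=x+_{ab}(y+_{\frac{(1-a)b}{1-ab}}z)$ if $a,b<1$. Cones are barycentric algebras with $x+_ay=a\cdot x+(1-a)\cdot y$. It is semitopological if it has a topology making $(x,a,y)\mapsto x+_ay$ separately continuous, $[0,1]$ having its metric topology. A pointed semitopological barycentric algebra is a semitopological barycentric algebra with a distinguished element $\bot$ that is least in the specialization preordering; $a\cdot x$ denotes $x+_a\bot$ for $a\in[0,1]$. A semitopological cone is pointed with $\bot=0$. For maps $f$ between pointed semitopological barycentric algebras (preordered by specialization): affine: $f(x+_ay)=f(x)+_af(y)$; concave (convex): $f(x+_ay)\ge f(x)+_af(y)$ (resp. $\le$); strict: $f(\bot)=\bot$; $\mathbb I$-homogeneous: $f(a\cdot x)=a\cdot f(x)$ for $a\in[0,1]$; linear (superlinear,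 sublinear): $\mathbb I$-homogeneous and affine (resp. concave, convex). Between cones, positively homogeneous means $f(a\cdot x)=a\cdot f(x)$ for all $a\in\mathbb R_+$. $\mathrm{tscope}_\alpha(\mathcal B)$ is the quotient of $\coprod_{n\in\mathbb N}\mathcal B$ (pairs $(n,x)$ with $n\in\mathbb N$, $x\in\mathcal B$) by the smallest equivalence relation $\equiv_\alpha$ with $(n,x)\equiv_\alpha(n+1,\alpha\cdot x)$; $[(n,x)]_\alpha$ is the class of $(n,x)$; any two elements can be written $[(n,x)]_\alpha,[(n,y)]_\alpha$ with the same $n$. It is a cone with $[(n,x)]_\alpha+_a[(n,y)]_\alpha=[(n,x+_ay)]_\alpha$, zero $[(0,\bot)]_\alpha$, $a\cdot[(n,x)]_\alpha=[(n+k,(\alpha^ka)\cdot x)]_\alpha$ for any $k$ with $\alpha^ka\le1$ ($a\in\mathbb R_+$), and $u+v=2\cdot(u+_{1/2}v)$ (these are well defined). Its topology is the quotient topology of the coproduct topology. Free means: every linear continuous map from $\mathcal B$ to a semitopological cone factors uniquely through $\eta$ via a linear continuous map. *)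

(* Defs.v *)
From HB Require Import structures.
From mathcomp Require Import all_boot all_order all_algebra.
From mathcomp Require Import interval_inference.
From mathcomp Require Import all_classical all_reals topology convex.
From Stdlib Require Import Relation_Operators.
From mathcomp Require Import generic_quotient ring lra zify.

Set Implicit Arguments.
Unset Strict Implicit.
Unset Printing Implicit Defensive.

Import Order.TTheory GRing.Theory Num.Theory.
Import numFieldTopology.Exports.

Local Open Scope classical_set_scope.
Local Open Scope ring_scope.
Local Open Scope convex_scope.

Definition Rnneg (R : realType) : Type := {nonneg R}.

Section Rnneg.
Context {R : realType}.

HB.instance Definition _ := Choice.copy (Rnneg R) {nonneg R}.

Let add (a b : Rnneg R) : Rnneg R := (a%:num + b%:num)%:nng.
Let mul (a b : Rnneg R) : Rnneg R := (a%:num * b%:num)%:nng.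
Let zero : Rnneg R := 0%:nng.
Let one : Rnneg R := 1%:nng.

Let addA : associative add.
Proof. by move=> a b c; apply/val_inj; rewrite /= addrA. Qed.
Let addC : commutative add.
Proof. by move=> a b; apply/val_inj; rewrite /= addrC. Qed.
Let add0 : left_id zero add.
Proof. by move=> a; apply/val_inj; rewrite /= add0r. Qed.
Let mulA : associative mul.
Proof. by move=> a b c; apply/val_inj; rewrite /= mulrA. Qed.
Let mulC : commutative mul.
Proof. by move=> a b; apply/val_inj; rewrite /= mulrC. Qed.
Let mul1 : left_id one mul.
Proof. by move=> a; apply/val_inj; rewrite /= mul1r. Qed.
Let mulr1 : right_id one mul.
Proof. by move=> a; apply/val_inj; rewrite /= mulr1. Qed.
Let mulDl : left_distributive mul add.
Proof. by move=> a b c; apply/val_inj; rewrite /= mulrDl. Qed.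
Let mulDr : right_distributive mul add.
Proof. by move=> a b c; apply/val_inj; rewrite /= mulrDr. Qed.
Let mul0 : left_zero zero mul.
Proof. by move=> a; apply/val_inj; rewrite /= mul0r. Qed.
Let mulr0 : right_zero zero mul.
Proof. by move=> a; apply/val_inj; rewrite /= mulr0. Qed.
Let one_neq0 : one != zero.
Proof. by apply/eqP => /(congr1 val) /= /eqP; rewrite oner_eq0. Qed.

HB.instance Definition _ := GRing.isNzSemiRing.Build (Rnneg R)
  addA addC add0 mulA mul1 mulr1 mulDl mulDr mul0 mulr0 one_neq0.
HB.instance Definition _ := GRing.PzSemiRing_hasCommutativeMul.Build (Rnneg R) mulC.

Definition scott_open (U : set (Rnneg R)) : Prop :=
  [\/ U = set0, U = setT |
      exists a : Rnneg R, U = [set b : Rnneg R | a%:num < b%:num]].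

Let scott_openT : scott_open setT.
Proof. by constructor 2. Qed.

Let scott_openI : setI_closed scott_open.
Proof.
move=> U V [->|->|[a ->]]; first by rewrite set0I; constructor 1.
  by rewrite setTI.
move=> [->|->|[b ->]]; first by rewrite setI0; constructor 1.
  by rewrite setIT; constructor 3; exists a.
constructor 3; have [ab|ba] := leP a%:num b%:num.
  exists b; apply/seteqP; split => c /=; first by case.
  by move=> bc; split => //; exact: le_lt_trans bc.
exists a; apply/seteqP; split => c /=; first by case.
by move=> bc; split => //; exact: lt_trans bc.
Qed.

Let scott_open_bigU (I : Type) (f : I -> set (Rnneg R)) :
  (forall i, scott_open (f i)) -> scott_open (\bigcup_i f i).
Proof.
move=> of_; have [[i fiT]|nT] := pselect (exists i, f i = setT).
  by constructor 2; apply/seteqP; split => // x _; exists i => //; rewrite fiT.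
pose A := [set a : R | exists i (b : Rnneg R),
  a = b%:num /\ f i = [set c : Rnneg R | b%:num < c%:num]].
have [A0|/set0P nA0] := eqVneq A set0.
  constructor 1; apply/seteqP; split => // x [i _ fix_].
  case: (of_ i) => [fi|fi|[b fi]]; first by rewrite fi in fix_.
    by case: nT; exists i.
  suff : A b%:num by rewrite A0.
  by exists i, b.
have lbA : lbound A 0 by move=> _ [i [b [-> _]]].
have infA0 : 0 <= inf A by exact: lb_le_inf.
constructor 3; exists (NngNum infA0); apply/seteqP; split => x /=.
  move=> [i _]; case: (of_ i) => [->//|fi|[b fi]]; first by case: nT; exists i.
  rewrite fi /=; apply: le_lt_trans; apply: ge_inf; first by exists 0.
  by exists i, b.
move=> /inf_lt -/(_ nA0) [_ [i [b [-> fi]]] bx].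
by exists i => //; rewrite fi.
Qed.

HB.instance Definition _ := isOpenTopological.Build (Rnneg R)
  scott_openT scott_openI scott_open_bigU.

End Rnneg.

Definition i01_metric (R : realType) : Type :=
  initial_topology (fun a : {i01 R} => a%:num).
HB.instance Definition _ (R : realType) := Topological.copy (i01_metric R)
  (initial_topology (fun a : {i01 R} => a%:num)).

Definition nng01 {R : realType} (a : {i01 R}) : Rnneg R := a%:num%:nng.

HB.mixin Record hasBottom T := { bottom : T }.

(* x <| a |> y is x +_a y; the associativity law of ConvexSpace is the usual one
   with its division cleared (see conv_assoc). Neither continuity of the operations
   nor minimality of bottom is bundled: see pointed_semitopological_barycentric and
   semitopological_cone. *)
#[short(type="pbaryTopType")]
HB.structure Definition PBaryTop (R : realType) :=
  {B of ConvexSpace R B & Topological B & hasBottom B}.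

Definition iscale {R : realType} {B : pbaryTopType R} (a : {i01 R}) (x : B) : B :=
  x <| a |> bottom.

(* A cone is a semimodule over Rnneg R; its barycentric structure and its bottom are
   the ones determined by that semimodule structure. *)
HB.mixin Record isConeBary (R : realType) C
    of GRing.LSemiModule (Rnneg R) C & PBaryTop R C := {
  cone_convE : forall (a : {i01 R}) (x y : C),
    x <| a |> y = nng01 a *: x + nng01 (1 - a%:num)%:i01 *: y ;
  cone_bottomE : bottom = 0 :> C }.

#[short(type="coneTopType")]
HB.structure Definition ConeTop (R : realType) :=
  {C of GRing.LSemiModule (Rnneg R) C & PBaryTop R C & isConeBary R C}.


Definition semitopological_barycentric {R : realType} (B : pbaryTopType R) : Prop :=
  [/\ forall (a : {i01 R}) (y : B), continuous (fun x : B => x <| a |> y),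
      forall (a : {i01 R}) (x : B), continuous (fun y : B => x <| a |> y) &
      forall x y : B, continuous (fun a : i01_metric R => x <| a |> y)].

Definition specialization_le {T : topologicalType} (x y : T) : Prop :=
  forall U : set T, open U -> U x -> U y.

Definition pointed_semitopological_barycentric {R : realType}
    (B : pbaryTopType R) : Prop :=
  semitopological_barycentric B /\ forall x : B, specialization_le bottom x.

Definition semitopological_cone {R : realType} (C : coneTopType R) : Prop :=
  [/\ forall y : C, continuous (fun x : C => x + y),
      forall x : C, continuous (fun y : C => x + y),
      forall a : Rnneg R, continuous (fun x : C => a *: x) &
      forall x : C, continuous (fun a : Rnneg R => a *: x)].

Section maps.
Context {R : realType} {B B' : pbaryTopType R}.
Implicit Type f : B -> B'.

Definition affine_map f : Prop :=
  forall (a : {i01 R}) (x y : B), f (x <| a |> y) = f x <| a |> f y.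
Definition concave_map f : Prop :=
  forall (a : {i01 R}) (x y : B), specialization_le (f x <| a |> f y) (f (x <| a |> y)).
Definition convex_map f : Prop :=
  forall (a : {i01 R}) (x y : B), specialization_le (f (x <| a |> y)) (f x <| a |> f y).
Definition strict_map f : Prop := f bottom = bottom.
Definition commutes_with_scale (a : {i01 R}) f : Prop :=
  forall x : B, f (iscale a x) = iscale a (f x).
Definition I_homogeneous f : Prop := forall a : {i01 R}, commutes_with_scale a f.
Definition linear_map f : Prop := I_homogeneous f /\ affine_map f.
Definition superlinear_map f : Prop := I_homogeneous f /\ concave_map f.
Definition sublinear_map f : Prop := I_homogeneous f /\ convex_map f.
End maps.

Definition positively_homogeneous {R : realType} {C C' : coneTopType R}
    (f : C -> C') : Prop :=
  forall (a : Rnneg R) (x : C), f (a *: x) = a *: f x.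

Definition cone_isomorphism {R : realType} {C C' : coneTopType R}
    (f : C -> C') : Prop :=
  [/\ linear_map f, continuous f &
      exists g : C' -> C,
        [/\ linear_map g, continuous g, cancel f g & cancel g f]].

Definition free_semitopological_cone {R : realType} {B : pbaryTopType R}
    {T : coneTopType R} (i : B -> T) : Prop :=
  forall (C : coneTopType R) (f : B -> C),
    semitopological_cone C -> linear_map f -> continuous f ->
    exists! g : T -> C, [/\ linear_map g, continuous g & g \o i = f].

Section conv_facts.
Context {R : realType} {B : convType R}.
Implicit Types (a b p q r s : {i01 R}) (x y z : B).

Lemma conv_assoc r s q x y z :
  (1 - r%:num * s%:num) * q%:num = s%:num * (1 - r%:num) ->
  (x <| r |> y) <| s |> z = x <| (r%:num * s%:num)%:i01 |> (y <| q |> z).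
Proof.
move=> h; apply/esym/convA => //=; rewrite /unstable.onem.
by rewrite mulrBr mulr1 h; ring.
Qed.

Lemma convNC a x y : x <| (1 - a%:num)%:i01 |> y = y <| a |> x.
Proof. by rewrite [RHS]convC; congr conv; apply/val_inj. Qed.

Lemma conv_congr a b x y : a%:num = b%:num -> x <| a |> y = x <| b |> y.
Proof. by move=> ab; congr conv; apply/val_inj. Qed.

Lemma conv_quot (u v : R) : 0 <= u -> u <= v -> exists q : {i01 R}, v * q%:num = u.
Proof.
move=> u0 uv; have [v0|v0] := eqVneq v 0.
  by exists 0%:i01; rewrite v0 mul0r; apply/eqP; rewrite eq_le u0 -v0.
have vp : 0 < v by rewrite lt_neqAle eq_sym v0 (le_trans u0).
have h0 : 0 <= u / v by rewrite divr_ge0// ltW.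
have h1 : u / v <= 1 by rewrite ler_pdivrMr// mul1r.
by exists (Itv01 h0 h1); rewrite /= mulrC divfK.
Qed.

Lemma conv_assoc_ex r s x y z : exists q : {i01 R},
  (1 - r%:num * s%:num) * q%:num = s%:num * (1 - r%:num) /\
  (x <| r |> y) <| s |> z = x <| (r%:num * s%:num)%:i01 |> (y <| q |> z).
Proof.
have [r0 r1 s0 s1] := And4 (ge0 r) (le1 r) (ge0 s) (le1 s).
have [||q hq] := @conv_quot (s%:num * (1 - r%:num)) (1 - r%:num * s%:num).
- by rewrite mulr_ge0// subr_ge0.
- by rewrite mulrBr mulr1 mulrC lerD2r.
by exists q; split => //; exact: conv_assoc.
Qed.

Lemma conv_absorbl r s t x y : t%:num = r%:num * s%:num ->
  (x <| r |> y) <| s |> y = x <| t |> y.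
Proof.
move=> ht; have [q [_ ->]] := conv_assoc_ex r s x y y.
by rewrite convmm; exact: conv_congr.
Qed.

Lemma conv_absorbr r s t x y : t%:num = s%:num + (1 - s%:num) * r%:num ->
  x <| s |> (x <| r |> y) = x <| t |> y.
Proof.
move=> ht; rewrite convC [x <| r |> y]convC.
rewrite (@conv_absorbl _ _ (1 - t%:num)%:i01) ?convNC//.
by rewrite /= ht; ring.
Qed.

Lemma conv_same a b p s x y :
  s%:num = p%:num * a%:num + (1 - p%:num) * b%:num ->
  (x <| a |> y) <| p |> (x <| b |> y) = x <| s |> y.
Proof.
move=> hs; have [q [hq ->]] := conv_assoc_ex a p x y (x <| b |> y).
rewrite [y <| q |> _]convC.
rewrite (@conv_absorbl _ _ (b%:num * (1 - q%:num))%:i01)//.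
rewrite (@conv_absorbr _ _ s)//= hs.
transitivity (a%:num * p%:num + b%:num * ((1 - a%:num * p%:num) -
  (1 - a%:num * p%:num) * q%:num)); last by ring.
by rewrite hq; ring.
Qed.

Lemma conv_medial p q x y z t :
  (x <| q |> y) <| p |> (z <| q |> t) = (x <| p |> z) <| q |> (y <| p |> t).
Proof.
have [a [ha ->]] := conv_assoc_ex q p x y (z <| q |> t).
have [b [hb ->]] := conv_assoc_ex p q x z (y <| p |> t).
rewrite (@conv_congr (q%:num * p%:num)%:i01 (p%:num * q%:num)%:i01); last first.
  by rewrite /= mulrC.
have [pq1|pq1] := eqVneq (p%:num * q%:num) 1.
  have E w : x <| (p%:num * q%:num)%:i01 |> w = x.
    by rewrite -[RHS](conv1 x w); exact: conv_congr.
  by rewrite !E.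
congr (_ <| _ |> _).
have [p0 p1 q0 q1] := And4 (ge0 p) (le1 p) (ge0 q) (le1 q).
have [a0 a1 b0 b1] := And4 (ge0 a) (le1 a) (ge0 b) (le1 b).
have npq : 1 - p%:num * q%:num != 0 by rewrite subr_eq0 eq_sym.
rewrite [q%:num * _]mulrC in ha.
have [||c hc] := @conv_quot a%:num (a%:num + (1 - a%:num) * q%:num) => //.
  by rewrite lerDl mulr_ge0// subr_ge0.
have s0 : 0 <= a%:num + (1 - a%:num) * q%:num.
  by rewrite addr_ge0// mulr_ge0// subr_ge0.
have s1 : a%:num + (1 - a%:num) * q%:num <= 1.
  by rewrite -lerBrDl -[leRHS]mulr1 ler_wpM2l// subr_ge0.
pose s : {i01 R} := Itv01 s0 s1.
have -> : y <| a |> (z <| q |> t) = (y <| c |> z) <| s |> t.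
  by apply: convA => /=; rewrite /unstable.onem; [rewrite mulrC hc | ring].
have -> : z <| b |> (y <| p |> t) = (z <| (1 - c%:num)%:i01 |> y) <| s |> t.
  have hs : a%:num + (1 - a%:num) * q%:num = b%:num + (1 - b%:num) * p%:num.
    apply: (mulfI npq).
    transitivity ((1 - p%:num * q%:num) * a%:num * (1 - q%:num) +
      q%:num * (1 - p%:num * q%:num)); first by ring.
    transitivity ((1 - p%:num * q%:num) * b%:num * (1 - p%:num) +
      p%:num * (1 - p%:num * q%:num)); last by ring.
    by rewrite ha hb; ring.
  apply: convA => /=; last by rewrite /unstable.onem hs; ring.
  apply: (mulfI npq); rewrite hb.
  transitivity ((1 - p%:num * q%:num) * ((a%:num + (1 - a%:num) * q%:num) -
     (a%:num + (1 - a%:num) * q%:num) * c%:num)); last by ring.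
  rewrite hc.
  transitivity ((1 - p%:num * q%:num) * q%:num -
     q%:num * ((1 - p%:num * q%:num) * a%:num)); first by rewrite ha; ring.
  by ring.
by rewrite convNC.
Qed.

End conv_facts.

Section iscale_facts.
Context {R : realType} {B : pbaryTopType R}.
Implicit Types (a b p : {i01 R}) (x y : B).

Lemma iscale_congr a b x : a%:num = b%:num -> iscale a x = iscale b x.
Proof. exact: conv_congr. Qed.

Lemma iscaleA a b c x : c%:num = a%:num * b%:num ->
  iscale a (iscale b x) = iscale c x.
Proof. by move=> h; apply: conv_absorbl; rewrite h mulrC. Qed.

Lemma iscale1 a x : a%:num = 1 -> iscale a x = x.
Proof. by move=> h; rewrite -[RHS](conv1 x bottom); exact: conv_congr. Qed.

Lemma iscale0 a x : a%:num = 0 -> iscale a x = bottom.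
Proof. by move=> h; rewrite -[RHS](conv0 x bottom); exact: conv_congr. Qed.

Lemma iscale_bottom a : iscale a bottom = bottom :> B.
Proof. exact: convmm. Qed.

Lemma iscale_conv a p x y :
  iscale a (x <| p |> y) = iscale a x <| p |> iscale a y.
Proof. by rewrite /iscale -conv_medial convmm. Qed.

End iscale_facts.

Lemma cone_iscaleE {R : realType} {C : coneTopType R} (a : {i01 R}) (x : C) :
  iscale a x = nng01 a *: x.
Proof. by rewrite /iscale cone_convE cone_bottomE scaler0 addr0. Qed.

Section half.
Context {R : realType}.

Lemma half_ge0 : 0 <= 2^-1 :> R. Proof. by rewrite invr_ge0. Qed.
Lemma half_le1 : 2^-1 <= 1 :> R. Proof. by rewrite invf_le1// ler1n. Qed.
Definition half01 : {i01 R} := Itv01 half_ge0 half_le1.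

End half.

Section tscope_def.
Local Open Scope quotient_scope.
Context {R : realType} (alpha : {itv R & `]0, 1[}) (B : pbaryTopType R).

Definition alpha_pow (k : nat) : {i01 R} := (alpha%:num ^+ k)%:i01.

Definition tscope_step (u v : {n : nat & B}) : Prop :=
  v = existT _ (tag u).+1 (iscale alpha%:num%:i01 (tagged u)).

Definition tscope_rel (u v : {n : nat & B}) : bool :=
  `[< clos_refl_sym_trans _ tscope_step u v >].

Lemma tscope_rel_refl : reflexive tscope_rel.
Proof. by move=> u; apply/asboolP; exact: rst_refl. Qed.

Lemma tscope_rel_sym : symmetric tscope_rel.
Proof. by move=> u v; apply/asboolP/asboolP => h; exact: rst_sym. Qed.

Lemma tscope_rel_trans : transitive tscope_rel.
Proof.
by move=> v u w /asboolP uv /asboolP vw; apply/asboolP; exact: rst_trans vw.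
Qed.

Canonical tscope_equiv :=
  EquivRel tscope_rel tscope_rel_refl tscope_rel_sym tscope_rel_trans.

Definition tscope : Type := quotient_topology {eq_quot tscope_equiv}.

HB.instance Definition _ :=
  Topological.copy tscope (quotient_topology {eq_quot tscope_equiv}).
HB.instance Definition _ :=
  Quotient.copy tscope (quotient_topology {eq_quot tscope_equiv}).

Definition tscope_class (n : nat) (x : B) : tscope :=
  \pi_tscope (existT (fun=> B) n x).

Definition tscope_unit (x : B) : tscope := tscope_class 0 x.

Lemma tscope_class_surj (u : tscope) : exists n x, u = tscope_class n x.
Proof. by elim/quotW: u => -[n x]; exists n, x. Qed.

Lemma tscope_classS n x :
  tscope_class n x = tscope_class n.+1 (iscale alpha%:num%:i01 x).
Proof.
apply: (elimT (@eqmodP _ tscope_equiv _ _)).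
by apply/asboolP; exact: rst_step.
Qed.

Lemma tscope_classD k n x :
  tscope_class n x = tscope_class (n + k) (iscale (alpha_pow k) x).
Proof.
elim: k => [|k IH]; first by rewrite addn0 iscale1//= expr0.
rewrite IH tscope_classS addnS; congr tscope_class.
by apply: iscaleA; rewrite /= exprS.
Qed.

Lemma tscope_classP n m x y : tscope_class n x = tscope_class m y ->
  exists k l, (n + k = m + l)%N /\ iscale (alpha_pow k) x = iscale (alpha_pow l) y.
Proof.
move=> /(introT (@eqmodP _ tscope_equiv _ _)) /asboolP.
suff H u v : clos_refl_sym_trans _ tscope_step u v ->
    exists k l, (tag u + k = tag v + l)%N /\
      iscale (alpha_pow k) (tagged u) = iscale (alpha_pow l) (tagged v).
  by move=> /H.
elim=> {u v} [u v ->|u|u v _ [k [l [kl E]]]|u v w _ [k [l [kl E]]] _ [k' [l' [kl' E']]]].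
- exists 1%N, 0%N; rewrite addn1 addn0; split => //=.
  by rewrite [RHS]iscale1 ?expr0//; apply: iscale_congr; rewrite /= expr1.
- by exists 0%N, 0%N.
- by exists l, k.
- exists (k + k')%N, (l + l')%N; split; first lia.
  rewrite -(@iscaleA _ _ (alpha_pow k') (alpha_pow k)) /=; last by rewrite mulrC exprD.
  rewrite E (@iscaleA _ _ _ _ (alpha_pow (k' + l))%N) /=; last by rewrite exprD.
  rewrite -(@iscaleA _ _ (alpha_pow l) (alpha_pow k')) /=; last by rewrite mulrC exprD.
  by rewrite E' (@iscaleA _ _ _ _ (alpha_pow (l + l'))%N) //= exprD.
Qed.

Lemma tscope_common2 (u v : tscope) :
  exists n x y, u = tscope_class n x /\ v = tscope_class n y.
Proof.
have [n [x ->]] := tscope_class_surj u; have [m [y ->]] := tscope_class_surj v.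
exists (n + m)%N, (iscale (alpha_pow m) x), (iscale (alpha_pow n) y).
by rewrite -tscope_classD addnC -tscope_classD.
Qed.

Lemma tscope_common3 (u v w : tscope) : exists n x y z,
  [/\ u = tscope_class n x, v = tscope_class n y & w = tscope_class n z].
Proof.
have [n [x [y [-> ->]]]] := tscope_common2 u v.
have [m [z ->]] := tscope_class_surj w.
exists (n + m)%N, (iscale (alpha_pow m) x), (iscale (alpha_pow m) y),
  (iscale (alpha_pow n) z).
by rewrite -!tscope_classD addnC -tscope_classD.
Qed.

(* independent of the representatives: see tscope_baryE *)
Definition tscope_bary (p : {i01 R}) (u v : tscope) : tscope :=
  let: existT n x := repr u in
  let: existT m y := repr v in
  tscope_class (n + m) (iscale (alpha_pow m) x <| p |> iscale (alpha_pow n) y).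

Lemma tscope_baryE p n x y :
  tscope_bary p (tscope_class n x) (tscope_class n y) =
  tscope_class n (x <| p |> y).
Proof.
rewrite /tscope_bary.
case Eu : (repr _) => [n1 x1]; case Ev : (repr _) => [n2 y2].
have {Eu} : tscope_class n1 x1 = tscope_class n x.
  by rewrite /tscope_class -Eu reprK.
have {Ev} : tscope_class n2 y2 = tscope_class n y.
  by rewrite /tscope_class -Ev reprK.
move=> /tscope_classP [k2 [l2 [kl2 E2]]] /tscope_classP [k1 [l1 [kl1 E1]]].
rewrite (tscope_classD (k1 + k2)) iscale_conv.
rewrite (@iscaleA _ _ _ _ (alpha_pow (k2 + n2 + k1))) /=; last first.
  by rewrite -exprD; congr (_ ^+ _); lia.
rewrite (@iscaleA _ _ _ _ (alpha_pow (k1 + n1 + k2)) y2) /=; last first.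
  by rewrite -exprD; congr (_ ^+ _); lia.
rewrite -(@iscaleA _ _ (alpha_pow (k2 + n2)) (alpha_pow k1)) /=; last first.
  by rewrite exprD.
rewrite -(@iscaleA _ _ (alpha_pow (k1 + n1)) (alpha_pow k2) _ y2) /=; last first.
  by rewrite exprD.
rewrite E1 E2 (@iscaleA _ _ _ _ (alpha_pow (k2 + n2 + l1))) /=; last first.
  by rewrite exprD.
rewrite (@iscaleA _ _ _ _ (alpha_pow (k1 + n1 + l2)) y) /=; last first.
  by rewrite exprD.
have -> : (k1 + n1 + l2 = k2 + n2 + l1)%N by lia.
rewrite -iscale_conv.
have -> : (n1 + n2 + (k1 + k2) = n + (k2 + n2 + l1))%N by lia.
by rewrite -tscope_classD.
Qed.

Lemma tscope_shift_ex (a : Rnneg R) : exists k, alpha%:num ^+ k * a%:num <= 1.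
Proof.
have al0 : 0 < alpha%:num :> R by [].
have al1 : alpha%:num < 1 :> R by [].
pose h : R := alpha%:num^-1 - 1.
have h0 : 0 < h by rewrite subr_gt0 invf_gt1.
have bern k : 1 + k%:R * h <= alpha%:num^-1 ^+ k.
  elim: k => [|k IH]; first by rewrite mul0r addr0 expr0.
  rewrite exprS (_ : alpha%:num^-1 = 1 + h); last by rewrite /h; ring.
  rewrite (_ : alpha%:num^-1 = 1 + h) in IH; last by rewrite /h; ring.
  apply: (@le_trans _ _ ((1 + h) * (1 + k%:R * h))); last first.
    by rewrite ler_wpM2l// addr_ge0// ltW.
  rewrite -natr1; have : 0 <= h * h * k%:R by rewrite !mulr_ge0// ltW.
  by nra.
have [k ak] : exists k : nat, a%:num / h <= k%:R.
  by exists (Num.bound (a%:num / h)); rewrite ltW// archi_boundP// divr_ge0// ltW.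
exists k; rewrite -(ler_pM2l (exprn_gt0 k (_ : 0 < alpha%:num^-1))) ?invr_gt0//.
rewrite mulrA -exprMn mulVf ?gt_eqF// expr1n mul1r mulr1.
apply: le_trans (bern k); move: ak; rewrite ler_pdivrMr// => ak; lra.
Qed.

Lemma tscope_factor_ge0 (a : Rnneg R) k : 0 <= alpha%:num ^+ k * a%:num.
Proof. by rewrite mulr_ge0// exprn_ge0. Qed.

Definition tscope_factor (a : Rnneg R) (k : nat)
    (ak : alpha%:num ^+ k * a%:num <= 1) : {i01 R} :=
  Itv01 (tscope_factor_ge0 a k) ak.

Definition tscope_shift (a : Rnneg R) : nat := ex_minn (tscope_shift_ex a).

Lemma tscope_shiftP (a : Rnneg R) : alpha%:num ^+ tscope_shift a * a%:num <= 1.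
Proof. by rewrite /tscope_shift; case: ex_minnP. Qed.

(* independent of the representative and of the shift: see tscope_scaleE *)
Definition tscope_scale (a : Rnneg R) (u : tscope) : tscope :=
  let: existT n x := repr u in
  tscope_class (n + tscope_shift a) (iscale (tscope_factor (tscope_shiftP a)) x).

Lemma tscope_scaleE (a : Rnneg R) k (ak : alpha%:num ^+ k * a%:num <= 1) n x :
  tscope_scale a (tscope_class n x) = tscope_class (n + k) (iscale (tscope_factor ak) x).
Proof.
rewrite /tscope_scale; case Eu : (repr _) => [n1 x1].
have {Eu} : tscope_class n1 x1 = tscope_class n x.
  by rewrite /tscope_class -Eu reprK.
move=> /tscope_classP [p [q [pq E]]].
set f := tscope_factor _; set g := tscope_factor _; set s := tscope_shift a.
rewrite (tscope_classD (p + k)).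
rewrite (@iscaleA _ _ _ _ (g%:num * (alpha_pow (p + s))%:num)%:i01) /=; last first.
  by rewrite !exprD; ring.
rewrite -(@iscaleA _ _ (g%:num * (alpha_pow s)%:num)%:i01 (alpha_pow p)) /=; last first.
  by rewrite !exprD; ring.
rewrite E (@iscaleA _ _ _ _ ((alpha_pow (s + q))%:num * g%:num)%:i01) /=; last first.
  by rewrite !exprD; ring.
rewrite -(@iscaleA _ _ (alpha_pow (s + q)) g)//.
have -> : (n1 + s + (p + k) = n + k + (s + q))%N by lia.
by rewrite -tscope_classD.
Qed.

Definition tscope_zero : tscope := tscope_class 0 bottom.

Definition tscope_add (u v : tscope) : tscope :=
  tscope_scale 2%:nng (tscope_bary half01 u v).

End tscope_def.

Section tscope_cone.
Context {R : realType} (alpha : {itv R & `]0, 1[}) (B : pbaryTopType R).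
Local Notation T := (tscope alpha B).
Local Notation cl := (@tscope_class R alpha B).
Implicit Types (u v w : T).

Let bary (p : {i01 R}) (u v : T) := tscope_bary p u v.

Let bary1 u v : bary 1%:i01 u v = u.
Proof.
have [n [x [y [-> ->]]]] := tscope_common2 u v.
by rewrite /bary tscope_baryE conv1.
Qed.

Let barymm p u : bary p u u = u.
Proof.
have [n [x ->]] := tscope_class_surj u.
by rewrite /bary tscope_baryE convmm.
Qed.

Let baryC p u v : bary p u v = bary (1 - p%:num)%:i01 v u.
Proof.
have [n [x [y [-> ->]]]] := tscope_common2 u v.
by rewrite /bary !tscope_baryE convC.
Qed.

Let baryA : convex_quasi_associative bary.
Proof.
move=> p q r s u v w h1 h2.
have [n [x [y [z [-> -> ->]]]]] := tscope_common3 u v w.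
by rewrite /bary !tscope_baryE (@convA _ _ p q r s x y z h1 h2).
Qed.

HB.instance Definition _ := isConvexSpace.Build R T bary1 barymm baryC baryA.
HB.instance Definition _ := hasBottom.Build T (tscope_zero alpha B).

Lemma tscope_convE p n x y : cl n x <| p |> cl n y = cl n (x <| p |> y).
Proof. exact: tscope_baryE. Qed.

Let scale (a : Rnneg R) (u : T) := tscope_scale a u.

Let scale_classE (a : Rnneg R) k (b : {i01 R}) n x :
  b%:num = alpha%:num ^+ k * a%:num ->
  scale a (cl n x) = cl (n + k) (iscale b x).
Proof.
move=> hb; have ak : alpha%:num ^+ k * a%:num <= 1 by rewrite -hb le1.
by rewrite /scale (tscope_scaleE ak); congr tscope_class; exact: iscale_congr.
Qed.

Let scale_i01 (a : {i01 R}) n x : scale (nng01 a) (cl n x) = cl n (iscale a x).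
Proof. by rewrite (@scale_classE _ 0 a) ?addn0// expr0 mul1r. Qed.

Let scale_conv (a : Rnneg R) p u v : scale a (u <| p |> v) = scale a u <| p |> scale a v.
Proof.
have [n [x [y [-> ->]]]] := tscope_common2 u v.
have ak := tscope_shiftP alpha a; set b := tscope_factor ak.
have hb : b%:num = alpha%:num ^+ tscope_shift alpha a * a%:num by [].
by rewrite tscope_convE !(scale_classE _ _ hb) tscope_convE iscale_conv.
Qed.

Let scaleA (a b : Rnneg R) u : scale a (scale b u) = scale (a * b) u.
Proof.
have [n [x ->]] := tscope_class_surj u.
have ak := tscope_shiftP alpha a; have bk := tscope_shiftP alpha b.
set k := tscope_shift alpha a in ak; set l := tscope_shift alpha b in bk.
have hab : (alpha%:num ^+ k * a%:num) * (alpha%:num ^+ l * b%:num) =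
    alpha%:num ^+ (l + k) * (a * b)%R%:num by rewrite /= exprD; ring.
rewrite (@scale_classE b l (tscope_factor bk))// (@scale_classE a k (tscope_factor ak))//.
have [c hc] : exists c : {i01 R}, c%:num = (tscope_factor ak)%:num * (tscope_factor bk)%:num.
  by exists ((tscope_factor ak)%:num * (tscope_factor bk)%:num)%:i01.
by rewrite (iscaleA (c := c))// (@scale_classE _ (l + k) c) ?addnA// hc.
Qed.

Let half := @half01 R.
Let two : Rnneg R := 2%:nng.
Let add u v := scale two (u <| half |> v).

Let scale1 u : scale 1 u = u.
Proof.
have [n [x ->]] := tscope_class_surj u.
rewrite (@scale_classE _ 0 1%:i01); first by rewrite iscale1 ?addn0.
by rewrite expr0 mul1r.
Qed.

Let two_half u : scale two (scale (nng01 half) u) = u.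
Proof.
rewrite scaleA -[RHS]scale1; congr scale.
by apply/val_inj; rewrite /= divff// pnatr_eq0.
Qed.

Let class_bottom n : cl n bottom = tscope_zero alpha B.
Proof. by rewrite /tscope_zero (tscope_classD alpha n 0) iscale_bottom. Qed.

Let scale_half u : scale (nng01 half) u = u <| half |> tscope_zero alpha B.
Proof.
have [n [x ->]] := tscope_class_surj u.
by rewrite scale_i01 -(class_bottom n) tscope_convE.
Qed.

Let addC : commutative add.
Proof.
move=> u v; rewrite /add convC; congr (scale _ (conv _ _ _)).
by apply/val_inj => /=; field.
Qed.

Let add0 : left_id (tscope_zero alpha B) add.
Proof. by move=> u; rewrite addC /add -scale_half two_half. Qed.

Let addA : associative add.
Proof.
move=> u v w; rewrite /add; congr scale.
rewrite -[X in X <| _ |> _]two_half -[X in _ = _ <| _ |> X]two_half.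
rewrite -!scale_conv; congr scale.
rewrite !scale_half conv_medial; congr (_ <| _ |> _).
rewrite convC; congr (conv _ _ _).
by apply/val_inj => /=; field.
Qed.

HB.instance Definition _ := GRing.isNmodule.Build T addA addC add0.

Let scale0 u : scale 0 u = 0.
Proof.
have [n [x ->]] := tscope_class_surj u.
rewrite (@scale_classE _ 0 0%:i01); last by rewrite /= mulr0.
by rewrite iscale0// class_bottom.
Qed.

Let scaleDr : right_distributive scale +%R.
Proof.
move=> a u v; rewrite -[(u + v)%R]/(add u v) -[RHS]/(add (scale a u) (scale a v)).
by rewrite /add -scale_conv !scaleA mulrC.
Qed.

Let scaleDl u : {morph scale^~ u : a b / a + b}.
Proof.
move=> a b; rewrite -[RHS]/(add (scale a u) (scale b u)) /add.
have [n [x ->]] := tscope_class_surj u.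
have abk := tscope_shiftP alpha (a + b); set k := tscope_shift _ _ in abk.
have h (c : Rnneg R) : c%:num <= a%:num + b%:num -> alpha%:num ^+ k * c%:num <= 1.
  by move=> cab; apply: le_trans abk; rewrite ler_wpM2l// exprn_ge0.
have ak : alpha%:num ^+ k * a%:num <= 1 by apply: h; rewrite lerDl.
have bk : alpha%:num ^+ k * b%:num <= 1 by apply: h; rewrite lerDr.
rewrite (@scale_classE a k (tscope_factor ak))// (@scale_classE b k (tscope_factor bk))//.
have [c hc] : exists c : {i01 R}, c%:num = half%:num * (tscope_factor abk)%:num.
  by exists (half%:num * (tscope_factor abk)%:num)%:i01.
rewrite tscope_convE (@conv_same _ _ _ _ _ c); last by rewrite hc /=; field.
rewrite -[_ <| _ |> bottom]/(iscale _ x) -(iscaleA _ hc).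
by rewrite -scale_i01 two_half (@scale_classE (a + b) k (tscope_factor abk)).
Qed.

HB.instance Definition _ := GRing.Nmodule_isLSemiModule.Build (Rnneg R) T
  scaleA scale0 scale1 scaleDr scaleDl.

Let cone_conv (p : {i01 R}) u v :
  u <| p |> v = nng01 p *: u + nng01 (1 - p%:num)%:i01 *: v.
Proof.
rewrite -[RHS]/(add (scale _ u) (scale _ v)) /add.
have [n [x [y [-> ->]]]] := tscope_common2 u v.
rewrite !scale_i01 !tscope_convE.
suff E (q : {i01 R}) : q%:num = 1 - p%:num ->
    iscale p x <| half |> iscale q y = iscale half (x <| p |> y).
  by rewrite E// -scale_i01 two_half.
move=> hq; have -> : iscale q y = bottom <| p |> y.
  by rewrite -convNC; exact: conv_congr.
rewrite iscale_conv {1}/iscale conv_medial [bottom <| _ |> y]convC.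
congr (_ <| _ |> _); last by apply: conv_congr => /=; field.
Qed.

HB.instance Definition _ := isConeBary.Build R T cone_conv erefl.

Lemma tscope_cone_scaleE (a : Rnneg R) k (b : {i01 R}) n x :
  b%:num = alpha%:num ^+ k * a%:num ->
  a *: (cl n x : T) = cl (n + k) (iscale b x).
Proof. exact: scale_classE. Qed.

Lemma tscope_cone_addE u v : u + v = (2%:nng : Rnneg R) *: (u <| half01 |> v).
Proof. by []. Qed.

Lemma tscope_cone_zeroE : 0 = cl 0 bottom :> T.
Proof. by []. Qed.

Lemma tscope_openE (U : set T) : open U <-> forall n, open (cl n @^-1` U).
Proof. exact: sigT_openP. Qed.

End tscope_cone.

Section naturality.
Context {R : realType}.

(* The free-cone functor sends a linear continuous map h to the linear continuous
   map g with g \o tscope_unit = tscope_unit \o h, unique when B is pointed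
   semitopological. *)
Definition tscope_lift (alpha : {itv R & `]0, 1[}) {B B' : pbaryTopType R}
    (h : B -> B') (g : tscope alpha B -> tscope alpha B') : Prop :=
  [/\ linear_map g, continuous g &
      g \o @tscope_unit R alpha B = @tscope_unit R alpha B' \o h].

Definition tscope_naturally_isomorphic (alpha beta : {itv R & `]0, 1[}) : Prop :=
  exists phi : forall B : pbaryTopType R, tscope alpha B -> tscope beta B,
    [/\ forall B : pbaryTopType R, pointed_semitopological_barycentric B ->
          cone_isomorphism (phi B),
        forall B : pbaryTopType R, pointed_semitopological_barycentric B ->
          phi B \o @tscope_unit R alpha B = @tscope_unit R beta B &
        forall (B B' : pbaryTopType R) (h : B -> B')
            (ha : tscope alpha B -> tscope alpha B')
            (hb : tscope beta B -> tscope beta B'),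
          pointed_semitopological_barycentric B ->
          pointed_semitopological_barycentric B' ->
          linear_map h -> continuous h -> tscope_lift h ha -> tscope_lift h hb ->
          phi B' \o ha = hb \o phi B].

End naturality.

(* Main.v *)
Require Import Defs.
From mathcomp Require Import all_boot all_order all_algebra.
From mathcomp Require Import interval_inference.
From mathcomp Require Import all_classical all_reals topology convex.
From mathcomp Require Import ring.

Set Implicit Arguments.
Unset Strict Implicit.
Unset Printing Implicit Defensive.

Import Order.TTheory GRing.Theory Num.Theory.
Import numFieldTopology.Exports.

Local Open Scope classical_set_scope.
Local Open Scope ring_scope.
Local Open Scope convex_scope.

(** In the telescope, the n-th copy of B stands for B magnified by alpha^-n, so a map
on the telescope that commutes with alpha is forced by its restriction f to B: it must
send the class of (n, x) to alpha^-n f(x) ([extension_classE]). This formula is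
well defined as soon as f commutes with alpha ([extension_exists]), and it reads f on
one copy of B followed by a scaling of the target cone. Scaling in a semitopological
cone is continuous, hence monotone, and it commutes with barycenters, so every
property of f (continuity, affinity, concavity, homogeneity, and so on) is transported
to the extension, copy by copy.

Continuity out of the telescope is also checked copy by copy ([tscope_continuousP]),
which settles addition and scaling by a constant. The delicate point is that
a |-> a u is continuous for the Scott topology of the nonnegative reals, although B
only gives continuity for the metric topology of [0,1]. A map out of the Scott reals
is continuous as soon as it is monotone and every open set that contains its value at
some a > 0 also contains its value at a smaller point ([continuous_scott]).
Monotonicity holds because bottom is least: shrinking a point moves it towards bottom
([iscale_le]). The second condition follows from metric continuity
([iscale_open_below]).

The telescope is thus a free cone on B for every alpha. Two free cones on the same
objects are naturally isomorphic, by uniqueness of extensions alone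
([free_cones_naturally_isomorphic]). *)

(** * Specialization preordering *)

Lemma continuousT_comp (X Y Z : topologicalType) (g : Y -> Z) (f : X -> Y) :
  continuous g -> continuous f -> continuous (g \o f).
Proof. by move=> cg cf x; apply: continuous_comp; [exact: cf | exact: cg]. Qed.

Lemma continuous_specialization_le (S T : topologicalType) (f : S -> T) (x y : S) :
  continuous f -> specialization_le x y -> specialization_le (f x) (f y).
Proof. by move=> /continuousP cf xy U oU; exact: (xy _ (cf _ oU)). Qed.

(** The preimage of an open set under a monotone map is an up-closed set of nonnegative
reals; such a set is Scott open exactly when it has no least element, unless that element is 0. *)
Lemma continuous_scott (R : realType) (T : topologicalType) (g : Rnneg R -> T) :
  (forall a b : Rnneg R, a%:num <= b%:num -> specialization_le (g a) (g b)) ->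
  (forall (a : Rnneg R) (U : set T), 0 < a%:num -> open U -> U (g a) ->
    exists2 b : Rnneg R, b%:num < a%:num & U (g b)) ->
  continuous g.
Proof.
move=> mono below a V; rewrite nbhsE => -[U [oU Ua] UV].
apply: (@filterS _ (nbhs a) _ (g @^-1` U)); first by move=> b /UV.
have [a0|a_gt0] := leP a%:num 0.
  (* An up-closed set that contains 0 is everything. *)
  apply: (@filterS _ _ _ setT); last exact: filterT.
  by move=> b _; apply: (mono a) Ua => //; exact: le_trans a0 _.
have [b ba Ub] := below a U a_gt0 oU Ua.
rewrite nbhsE; exists [set c : Rnneg R | b%:num < c%:num].
  by split => //; constructor 3; exists b.
by move=> c /= bc; apply: (mono b) Ub => //; exact: ltW.
Qed.

(** * Scaling in a pointed semitopological barycentric algebra *)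

Section iscale_topology.
Context {R : realType} {B : pbaryTopType R}.
Hypothesis hB : pointed_semitopological_barycentric B.

Lemma iscale_continuous (a : {i01 R}) : continuous (iscale a : B -> B).
Proof. by case: hB => -[+ _ _] _; apply. Qed.

Lemma conv_continuousl (a : {i01 R}) (y : B) : continuous (fun x : B => x <| a |> y).
Proof. by case: hB => -[+ _ _] _; apply. Qed.

(** With s = q t, the point s x is the barycenter of t x and bottom with weight q; it
lies below the same barycenter with bottom replaced by t x, which is t x itself. *)
Lemma iscale_le (s t : {i01 R}) (x : B) :
  s%:num <= t%:num -> specialization_le (iscale s x) (iscale t x).
Proof.
move=> st; have [q tq] := conv_quot (ge0 s) st.
rewrite -(@iscaleA _ _ q t s); last by rewrite -tq mulrC.
rewrite -[X in specialization_le _ X](convmm q).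
case: hB => -[_ cr _] lb; exact: continuous_specialization_le (cr q _) (lb _).
Qed.

(** This is where continuity in the weight is used, for the metric topology: it gives
an open interval around t, and only its part to the left of t matters. *)
Lemma iscale_open_below (t : {i01 R}) (x : B) (U : set B) :
  0 < t%:num -> open U -> U (iscale t x) ->
  exists2 s : {i01 R}, s%:num < t%:num & U (iscale s x).
Proof.
move=> t0 oU Ut; case: hB => -[_ _ /(_ x Defs.bottom) /continuousP /(_ U oU)] + _.
move=> [O oO OE]; have {Ut} Ot : O t%:num.
  have : U (iscale t x) by [].
  by rewrite -[U _]/(((fun a => x <| a |> Defs.bottom) @^-1` U) t) -OE.
have : nbhs t%:num O by exact: open_nbhs_nbhs.
move=> /nbhs_ballP [e /= e0 eO].
(* Half the radius keeps s strictly inside the ball; the maximum keeps it a weight. *)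
pose s := Num.max 0 (t%:num - e / 2).
have s0 : 0 <= s by rewrite le_max lexx.
have st : s < t%:num by rewrite gt_max t0/= ltrBlDr ltrDl divr_gt0.
have s1 : s <= 1 by apply: le_trans (ltW st) _; exact: le1.
exists (Itv01 s0 s1) => //.
have : O s.
  apply: eO; rewrite /ball /= ger0_norm ?subr_ge0 ?ltW// ltrBlDl -ltrBlDr.
  apply: (@lt_le_trans _ _ (t%:num - e / 2)); last by rewrite le_max lexx orbT.
  by rewrite ltrD2l ltrN2 ltr_pdivrMr// ltr_pMr// ltr1n.
by rewrite -[O s]/(((fun a : {i01 R} => a%:num) @^-1` O) (Itv01 s0 s1)) OE.
Qed.

End iscale_topology.

(** * The telescope is a semitopological cone *)

Section tscope_semitopological.
Context {R : realType} (alpha : {itv R & `]0, 1[}) (B : pbaryTopType R).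
Local Notation T := (tscope alpha B).
Local Notation cl := (@tscope_class R alpha B).

Lemma alpha_pow_gt0 n : 0 < alpha%:num ^+ n :> R.
Proof. by rewrite exprn_gt0. Qed.

Lemma tscope_continuousP (Z : topologicalType) (f : T -> Z) :
  (forall n, continuous (f \o cl n)) <-> continuous f.
Proof.
split=> cf.
  apply/continuousP => U oU; apply/tscope_openE => n.
  by move/continuousP: (cf n); exact.
move=> n; apply/continuousP => U oU.
by move/continuousP: cf => /(_ U oU) /tscope_openE; exact.
Qed.

Lemma tscope_class_continuous n : continuous (cl n).
Proof. by apply: ((tscope_continuousP id).2 _ n) => x; exact: cvg_id. Qed.

Lemma tscope_alpha_class n k (x : B) :
  nng01 (alpha_pow alpha k) *: (cl (n + k) x : T) = cl n x.
Proof.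
rewrite (@tscope_cone_scaleE _ _ _ _ 0 (alpha_pow alpha k)) ?expr0 ?mul1r//.
by rewrite addn0 -tscope_classD.
Qed.

Lemma tscope_i01_scaleE (a : {i01 R}) n (x : B) : iscale a (cl n x : T) = cl n (iscale a x).
Proof.
by rewrite cone_iscaleE (@tscope_cone_scaleE _ _ _ _ 0 a) ?expr0 ?mul1r// addn0.
Qed.

Lemma tscope_unit_linear : linear_map (@tscope_unit R alpha B).
Proof.
split=> [a x|a x y]; first by rewrite tscope_i01_scaleE.
by rewrite /tscope_unit tscope_convE.
Qed.

Hypothesis hB : pointed_semitopological_barycentric B.

Lemma tscope_scale_continuous (a : Rnneg R) : continuous (fun u : T => a *: u).
Proof.
apply/tscope_continuousP => n.
have ak := tscope_shiftP alpha a.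
rewrite [X in continuous X](_ : _ = cl (n + tscope_shift alpha a) \o
    iscale (tscope_factor ak)); last first.
  by apply/funext => x /=; exact: tscope_cone_scaleE.
move=> x; apply: continuous_comp; first exact: iscale_continuous.
exact: tscope_class_continuous.
Qed.

Lemma tscope_conv_continuousl (a : {i01 R}) (v : T) :
  continuous (fun u : T => u <| a |> v).
Proof.
have [m [y ->]] := tscope_class_surj v.
apply/tscope_continuousP => n.
rewrite [X in continuous X](_ : _ = cl (n + m) \o
    (fun x => x <| a |> iscale (alpha_pow alpha n) y) \o iscale (alpha_pow alpha m)).
  move=> x; apply: continuous_comp; first exact: iscale_continuous.
  apply: continuous_comp; first exact: conv_continuousl.
  exact: tscope_class_continuous.
apply/funext => x /=.
by rewrite (tscope_classD alpha m n x) (tscope_classD alpha n m y) addnC tscope_convE.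
Qed.

Lemma tscope_add_continuousl (v : T) : continuous (fun u : T => u + v).
Proof.
move=> u; apply: (@continuous_comp _ _ _ (fun u : T => u <| half01 |> v)
  (fun w : T => (2%:nng : Rnneg R) *: w)).
  exact: tscope_conv_continuousl.
exact: tscope_scale_continuous.
Qed.

(** Both conditions of [continuous_scott] take place in a single copy of B once the
scalars have been multiplied by a power of alpha that makes them weights. *)
Lemma tscope_scale_continuousl (u : T) : continuous (fun a : Rnneg R => a *: u).
Proof.
have [n [x ->]] := tscope_class_surj u.
apply: continuous_scott => [a b ab|a U a0 oU Ua].
  have bk := tscope_shiftP alpha b; set k := tscope_shift alpha b in bk.
  have ak : alpha%:num ^+ k * a%:num <= 1.
    by apply: le_trans bk; rewrite ler_wpM2l// ltW// alpha_pow_gt0.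
  rewrite (@tscope_cone_scaleE _ _ _ a k (tscope_factor ak))//.
  rewrite (@tscope_cone_scaleE _ _ _ b k (tscope_factor bk))//.
  apply: continuous_specialization_le (@tscope_class_continuous _) _.
  by apply: iscale_le => //=; rewrite ler_wpM2l// ltW// alpha_pow_gt0.
have ak := tscope_shiftP alpha a; set k := tscope_shift alpha a in ak.
have alk := alpha_pow_gt0 k.
have aE : (tscope_factor ak)%:num = alpha%:num ^+ k * a%:num by [].
move: Ua; rewrite (@tscope_cone_scaleE _ _ _ a k (tscope_factor ak))// => Ua.
have [||s st Us] := @iscale_open_below _ _ hB (tscope_factor ak) x
  (cl (n + k) @^-1` U) _ _ Ua.
- by rewrite aE mulr_gt0.
- by move/tscope_openE : oU; exact.
(* Undoing the shift by alpha^k turns a weight below alpha^k a into a scalar below a. *)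
have b0 : 0 <= s%:num / alpha%:num ^+ k by rewrite divr_ge0// ltW.
exists (NngNum b0 : Rnneg R) => /=; first by rewrite ltr_pdivrMr// mulrC -aE.
rewrite (@tscope_cone_scaleE _ _ _ _ k s)//=.
by rewrite mulrC divfK// gt_eqF.
Qed.

Lemma tscope_semitopological_cone : semitopological_cone T.
Proof.
split.
- exact: tscope_add_continuousl.
- move=> u; rewrite [X in continuous X](_ : _ = fun v => v + u).
    exact: tscope_add_continuousl.
  by apply/funext => v; rewrite addrC.
- exact: tscope_scale_continuous.
- exact: tscope_scale_continuousl.
Qed.

End tscope_semitopological.

(** * The universal property *)

Section extension.
Context {R : realType} (alpha : {itv R & `]0, 1[}) (B : pbaryTopType R)
  (C : coneTopType R).
Hypothesis hC : semitopological_cone C.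
Local Notation T := (tscope alpha B).
Local Notation cl := (@tscope_class R alpha B).
Local Notation al := (alpha%:num%:i01 : {i01 R}).
Implicit Types (f : B -> C) (g : T -> C).

Definition alpha_inv n : Rnneg R := ((alpha%:num ^+ n)^-1)%:nng.

Lemma alpha_invK n (x : C) : alpha_inv n *: (nng01 (alpha_pow alpha n) *: x) = x.
Proof.
rewrite scalerA -[RHS]scale1r; congr (_ *: _).
by apply/val_inj; rewrite /= mulVf// gt_eqF// alpha_pow_gt0.
Qed.

Lemma alpha_invD n k : alpha_inv (n + k) * nng01 (alpha_pow alpha k) = alpha_inv n.
Proof.
apply/val_inj; rewrite /= exprD invfM -mulrA mulVf ?mulr1// gt_eqF//.
Qed.

Lemma commutes_alpha_pow (D : pbaryTopType R) (h : D -> C) k :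
  commutes_with_scale al h -> commutes_with_scale (alpha_pow alpha k) h.
Proof.
move=> hal x; elim: k => [|k IH]; first by rewrite !iscale1//= expr0.
rewrite -(@iscaleA _ _ al (alpha_pow alpha k)) /= ?exprS//.
by rewrite hal IH (@iscaleA _ _ _ _ (alpha_pow alpha k.+1)) //= exprS.
Qed.

(** The class of (n, x) scaled by alpha^n is the image of x under the unit, where the
map is prescribed; the factor alpha^n can then be cancelled in the target cone. *)
Lemma extension_classE f g :
  commutes_with_scale al g -> g \o @tscope_unit R alpha B = f ->
  forall n x, g (cl n x) = alpha_inv n *: f x.
Proof.
move=> gal <- n x /=; rewrite -[LHS](alpha_invK n) -cone_iscaleE.
rewrite -(commutes_alpha_pow n gal) cone_iscaleE.
by rewrite (tscope_alpha_class alpha 0 n).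
Qed.

(** Two representatives of the same class agree after applying powers of alpha, which f
lets through and which the scalar alpha^-n absorbs. *)
Lemma extension_exists f : commutes_with_scale al f ->
  exists g, forall n x, g (cl n x) = alpha_inv n *: f x.
Proof.
move=> fal; exists (fun u => let: existT n x := repr u in alpha_inv n *: f x) => n x.
case Eu : (repr _) => [m y].
have {Eu} : cl m y = cl n x by rewrite /tscope_class -Eu reprK.
move=> /tscope_classP [k [l [kl E]]].
rewrite -(alpha_invD m k) -(alpha_invD n l) kl -!scalerA -!cone_iscaleE.
by rewrite -!(commutes_alpha_pow _ fal) E.
Qed.

Section properties.
Variables (f : B -> C) (g : T -> C).
Hypothesis gE : forall n x, g (cl n x) = alpha_inv n *: f x.

Lemma extension_unit : g \o @tscope_unit R alpha B = f.
Proof.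
apply/funext => x /=; rewrite gE -[RHS]scale1r; congr (_ *: _).
by apply/val_inj; rewrite /= expr0 invr1.
Qed.

Lemma extension_commutes (a : {i01 R}) :
  commutes_with_scale a f -> commutes_with_scale a g.
Proof.
move=> fa u; have [n [x ->]] := tscope_class_surj u.
by rewrite tscope_i01_scaleE !gE fa !cone_iscaleE !scalerA mulrC.
Qed.

Lemma extension_continuous : continuous f -> continuous g.
Proof.
move=> cf; apply/tscope_continuousP => n.
rewrite [X in continuous X](_ : _ = (fun y => alpha_inv n *: y) \o f).
  by move=> x; apply: continuous_comp; [exact: cf | case: hC => _ _ + _; apply].
by apply/funext => x /=; rewrite gE.
Qed.

Lemma scale_conv_cone (c : Rnneg R) (a : {i01 R}) (x y : C) :
  c *: (x <| a |> y) = (c *: x) <| a |> (c *: y).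
Proof. by rewrite !cone_convE scalerDr !scalerA ![c * _]mulrC. Qed.

(** The specialization preordering is compatible with scaling in a cone; this is what
carries the inequalities of concave and convex maps from f to its extension. *)
Lemma scale_cone_le (c : Rnneg R) (x y : C) :
  specialization_le x y -> specialization_le (c *: x) (c *: y).
Proof.
by apply: continuous_specialization_le; case: hC => _ _ + _; apply.
Qed.

Lemma extension_affine : affine_map f -> affine_map g.
Proof.
move=> fa a u v; have [n [x [y [-> ->]]]] := tscope_common2 u v.
by rewrite tscope_convE !gE fa scale_conv_cone.
Qed.

Lemma extension_concave : concave_map f -> concave_map g.
Proof.
move=> fa a u v; have [n [x [y [-> ->]]]] := tscope_common2 u v.
by rewrite tscope_convE !gE -scale_conv_cone; exact: scale_cone_le.
Qed.

Lemma extension_convex : convex_map f -> convex_map g.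
Proof.
move=> fa a u v; have [n [x [y [-> ->]]]] := tscope_common2 u v.
by rewrite tscope_convE !gE -scale_conv_cone; exact: scale_cone_le.
Qed.

Lemma extension_strict : strict_map f -> strict_map g.
Proof.
move=> fs; rewrite /strict_map cone_bottomE tscope_cone_zeroE gE fs.
by rewrite !cone_bottomE scaler0.
Qed.

Lemma extension_homogeneous : I_homogeneous f -> I_homogeneous g.
Proof. by move=> fh a; exact: extension_commutes. Qed.

(** A scalar above 1 acts on the class of (n, x) by moving to the copy n + k, with a
weight alpha^k a on x; in the target, alpha^-(n+k) gives the factor alpha^k back. *)
Lemma extension_positively_homogeneous :
  I_homogeneous f -> positively_homogeneous g.
Proof.
move=> fh a u; have [n [x ->]] := tscope_class_surj u.
have ak := tscope_shiftP alpha a; set k := tscope_shift alpha a in ak.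
rewrite (@tscope_cone_scaleE _ _ _ a k (tscope_factor ak))// !gE fh cone_iscaleE.
rewrite !scalerA -(alpha_invD n k); congr (_ *: _).
by apply/val_inj => /=; ring.
Qed.

End properties.

Lemma extension_unique f : continuous f -> commutes_with_scale al f ->
  exists! g, [/\ continuous g, commutes_with_scale al g &
    g \o @tscope_unit R alpha B = f].
Proof.
move=> cf fal; have [g gE] := extension_exists fal.
exists g; split.
  by split; [exact: extension_continuous gE cf | exact: (extension_commutes gE fal) |
    exact: extension_unit].
move=> g' [_ g'al g'f]; apply/funext => u.
by have [n [x ->]] := tscope_class_surj u; rewrite gE (extension_classE g'al g'f).
Qed.

End extension.

Lemma tscope_free (R : realType) (alpha : {itv R & `]0, 1[}) (B : pbaryTopType R) :
  free_semitopological_cone (@tscope_unit R alpha B).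
Proof.
move=> C f hC [fh fa] cf.
have [g [[cg gal gf] guniq]] := extension_unique hC cf (fh alpha%:num%:i01).
have gE := extension_classE gal gf.
exists g; split; last first.
  by move=> g' [[g'h _] cg' g'f]; apply: guniq; split.
by split => //; split; [exact: extension_homogeneous gE fh | exact: extension_affine gE fa].
Qed.

(** * Natural isomorphism of free cones *)

Section free_cones.
Context {R : realType}.

Lemma linear_map_comp (A B C : pbaryTopType R) (f : B -> C) (g : A -> B) :
  linear_map f -> linear_map g -> linear_map (f \o g).
Proof.
by move=> [fh fa] [gh ga]; split => [a x|a x y] /=; [rewrite gh fh | rewrite ga fa].
Qed.

Definition free_cone_unit (B : pbaryTopType R) (T : coneTopType R) (i : B -> T) :=
  [/\ semitopological_cone T, linear_map i, continuous i & free_semitopological_cone i].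

Lemma free_cone_eq (B : pbaryTopType R) (T C : coneTopType R) (i : B -> T) (g h : T -> C) :
  free_cone_unit i -> semitopological_cone C ->
  linear_map g -> continuous g -> linear_map h -> continuous h ->
  g \o i = h \o i -> g = h.
Proof.
move=> [_ il ic fr] hC gl gc hl hc E.
have [||k [_ ku]] := fr C (h \o i) hC.
- exact: linear_map_comp.
- exact: continuousT_comp.
by rewrite -(ku g)// -(ku h).
Qed.

Lemma free_cone_isomorphism (B : pbaryTopType R) (T T' : coneTopType R)
    (i : B -> T) (j : B -> T') (phi : T -> T') :
  free_cone_unit i -> free_cone_unit j ->
  linear_map phi -> continuous phi -> phi \o i = j -> cone_isomorphism phi.
Proof.
move=> fi fj pl pc pE; split => //.
have [[hT il ic _] [hT' _ _ jfree]] := (fi, fj).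
have [psi [[sl sc sE] _]] := jfree T i hT il ic.
have psi_phi : psi \o phi = id.
  apply: (free_cone_eq fi hT) => //.
  - exact: linear_map_comp.
  - exact: continuousT_comp.
  - by move=> ?; exact: cvg_id.
  - by rewrite -compA pE sE.
have phi_psi : phi \o psi = id.
  apply: (free_cone_eq fj hT') => //.
  - exact: linear_map_comp.
  - exact: continuousT_comp.
  - by move=> ?; exact: cvg_id.
  - by rewrite -compA sE pE.
exists psi; split => // x; first exact: (congr1 (@^~ x) psi_phi).
exact: (congr1 (@^~ x) phi_psi).
Qed.

(** The comparison maps are chosen for all objects at once, those outside P receiving
the zero map. Naturality needs no computation: both sides of a naturality square are
linear continuous maps out of a free cone, and they agree on the generators. *)
Lemma free_cones_naturally_isomorphic (P : pbaryTopType R -> Prop)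
    (S T : pbaryTopType R -> coneTopType R)
    (i : forall B : pbaryTopType R, B -> S B) (j : forall B : pbaryTopType R, B -> T B) :
  (forall B, P B -> free_cone_unit (i B)) ->
  (forall B, P B -> free_cone_unit (j B)) ->
  exists phi : forall B, S B -> T B,
    [/\ forall B, P B -> cone_isomorphism (phi B),
        forall B, P B -> phi B \o i B = j B &
        forall (B B' : pbaryTopType R) (h : B -> B') (hS : S B -> S B') (hT : T B -> T B'),
          P B -> P B' ->
          [/\ linear_map hS, continuous hS & hS \o i B = i B' \o h] ->
          [/\ linear_map hT, continuous hT & hT \o j B = j B' \o h] ->
          phi B' \o hS = hT \o phi B].
Proof.
move=> fi fj.
have ex B : exists phi : S B -> T B, P B ->
    [/\ linear_map phi, continuous phi & phi \o i B = j B].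
  have [PB|nPB] := pselect (P B); last by exists (fun=> 0).
  have [[_ _ _ ifree] [hT jl jc _]] := (fi B PB, fj B PB).
  by have [phi [phiP _]] := ifree (T B) (j B) hT jl jc; exists phi.
pose phi B := sval (cid (ex B)).
have phiP B : P B -> [/\ linear_map (phi B), continuous (phi B) & phi B \o i B = j B].
  by rewrite /phi; case: cid.
exists phi; split.
- move=> B PB; have [pl pc pE] := phiP B PB.
  exact: (free_cone_isomorphism (fi B PB) (fj B PB)).
- by move=> B /phiP [].
- move=> B B' h hS hT PB PB' [hSl hSc hSE] [hTl hTc hTE].
  have [[pl pc pE] [pl' pc' pE']] := (phiP B PB, phiP B' PB').
  have [hTB' _ _ _] := fj B' PB'.
  apply: (free_cone_eq (fi B PB) hTB').
  + exact: linear_map_comp.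
  + exact: continuousT_comp.
  + exact: linear_map_comp.
  + exact: continuousT_comp.
  + by rewrite -[LHS]compA hSE [LHS]compA pE' -[RHS]compA pE hTE.
Qed.

End free_cones.

Lemma tscope_free_cone_unit (R : realType) (alpha : {itv R & `]0, 1[})
    (B : pbaryTopType R) :
  pointed_semitopological_barycentric B -> free_cone_unit (@tscope_unit R alpha B).
Proof.
move=> hB; split; [exact: tscope_semitopological_cone | exact: tscope_unit_linear |
  exact: tscope_class_continuous | exact: tscope_free].
Qed.

Lemma tscope_independent (R : realType) (alpha beta : {itv R & `]0, 1[}) :
  tscope_naturally_isomorphic alpha beta.
Proof.
have [phi [iso unit square]] := free_cones_naturally_isomorphic
  (tscope_free_cone_unit alpha) (tscope_free_cone_unit beta).
exists phi; split => // B B' h ha hb hB hB' _ _.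
exact: square.
Qed.

Theorem theorem4p22 (R : realType) (alpha : {itv R & `]0, 1[}) (B : pbaryTopType R)
    (hB : pointed_semitopological_barycentric B) :
  let eta : B -> tscope alpha B := @tscope_unit R alpha B in
  [/\ semitopological_cone (tscope alpha B),
      linear_map eta /\ continuous eta,
      forall (C : coneTopType R) (f : B -> C),
        semitopological_cone C -> continuous f ->
        commutes_with_scale alpha%:num%:i01 f ->
        let extends_f (g : tscope alpha B -> C) :=
          [/\ continuous g, commutes_with_scale alpha%:num%:i01 g & g \o eta = f] in
        (exists! g : tscope alpha B -> C, extends_f g) /\
        (forall g : tscope alpha B -> C, extends_f g ->
          (affine_map f -> affine_map g) /\
          (concave_map f -> concave_map g) /\
          (convex_map f -> convex_map g) /\
          (strict_map f -> strict_map g) /\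
          (linear_map f -> linear_map g) /\
          (superlinear_map f -> superlinear_map g) /\
          (sublinear_map f -> sublinear_map g) /\
          (I_homogeneous f -> positively_homogeneous g)),
      free_semitopological_cone eta &
      forall beta : {itv R & `]0, 1[}, tscope_naturally_isomorphic alpha beta].
Proof.
move=> eta; split.
- exact: tscope_semitopological_cone.
- by split; [exact: tscope_unit_linear | exact: tscope_class_continuous].
- move=> C f hC cf fal; split; first exact: extension_unique.
  move=> g [cg gal gf]; have gE := extension_classE gal gf.
  split; first exact: (extension_affine gE).
  split; first exact: (extension_concave hC gE).
  split; first exact: (extension_convex hC gE).
  split; first exact: (extension_strict gE).
  split.
    by case=> fh fa; split; [exact: (extension_homogeneous gE fh) |
      exact: (extension_affine gE fa)].
  split.
    by case=> fh fa; split; [exact: (extension_homogeneous gE fh) |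
      exact: (extension_concave hC gE fa)].
  split; last exact: (extension_positively_homogeneous gE).
  by case=> fh fa; split; [exact: (extension_homogeneous gE fh) |
      exact: (extension_convex hC gE fa)].
- exact: tscope_free.
- exact: tscope_independent.
Qed.
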